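(* For every positive rational number $x\in\mathbb{Q}_{>0}$, whose even-length continued fraction expansion is $[a_0;a_1,\dots,a_{2\ell-1}]$, the area statistics over the set of perfect matchings of the snake graph $\mathcal{G}(x)$ satisfies \[ \left(\begin{array}{r} \sum_{m\in \mathcal{M}^{\perp}(x)} q^{\mathrm{area}(m\Delta\mathfrak{b})}\\ \sum_{m\in \mathcal{M}^{\parallel}(x)} q^{\mathrm{area}(m\Delta\mathfrak{b})} \end{array}\right) = \left(\begin{smallmatrix} 1 & 0 \\ 0 & q \end{smallmatrix}\right)^{-1} R_q^{a_0}L_q^{a_1}\cdots R_q^{a_{2\ell-2}}L_q^{a_{2\ell-1}} \left(\begin{smallmatrix} 1 \\ 0 \end{smallmatrix}\right), \] where $\mathfrak{b}$ is the basic perfect matching of $\mathcal{G}(x)$.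
   Context: Here $q$ is an indeterminate, $L_q=\left(\begin{smallmatrix} q & 0\\ q & 1\end{smallmatrix}\right)$, $R_q=\left(\begin{smallmatrix} q & 1\\ 0 & 1\end{smallmatrix}\right)$, $a_0\ge0$, $a_i\ge1$ for $i\ge1$. Let $W(x)=\mathtt{1}^{a_0}\mathtt{0}^{a_1}\cdots\mathtt{1}^{a_{2\ell-2}}\mathtt{0}^{a_{2\ell-1}-1}$. Let $\theta:\{\mathtt{0},\mathtt{1}\}^*\to\{\mathtt{0},\mathtt{1}\}^*$ be defined by $\theta(\varepsilon)=\varepsilon$, $\theta(\alpha w)=\overline{\alpha}\theta(w)$ if $|w|$ even and $\alpha\theta(w)$ if $|w|$ odd (with $\overline{\mathtt{0}}=\mathtt{1}$, $\overline{\mathtt{1}}=\mathtt{0}$). For a word $w$, the snake graph $G(w)$ is the union of unit squares (with their four edges) at the points $\overrightarrow{p}=(|p|_\mathtt{0},|p|_\mathtt{1})$ for all prefixes $p$ of $w$ (letter $\mathtt{0}$ = east step, $\mathtt{1}$ = north step). Set $\mathcal{G}(x)=G(\theta(W(x)))$ and $\mathcal{M}(x)$ its set of perfect matchings. The basic matching $\mathfrak{b}$ is the perfect matching using only boundary edges whose last edge (containing the top-right vertex) is vertical. A matching $m$ of $G(w)$ is a $\perp$-matching if ($|w|$ even and its first edge, containing $(0,0)$, is horizontal) or ($|w|$ odd and its first edge is vertical); otherwise it is a $\parallel$-matching; $\mathcal{M}^\perp(x)$, $\mathcal{M}^\parallel(x)$ are the corresponding subsets. $\mathrm{area}(m\Delta\mathfrak{b})$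 is the area of the region enclosed by the cycles of the symmetric difference $m\Delta\mathfrak{b}$. *)

(* Defs.v *)
From mathcomp Require Import all_boot all_order all_algebra finmap.

Set Implicit Arguments.
Unset Strict Implicit.
Unset Printing Implicit Defensive.

Import Order.TTheory GRing.Theory Num.Theory.

Local Open Scope fset_scope.
Local Open Scope nat_scope.

(* [cf [:: a0; a1; ...; an]] is the value of [a0; a1, ..., an]; the value 0 on
   the empty sequence is a dummy. *)
Fixpoint cf (a : seq nat) : rat :=
  match a with
  | [::] => 0%R
  | [:: n] => (n%:R)%R
  | n :: a' => (n%:R + (cf a')^-1)%R
  end.

Definition cf_expansion (x : rat) (a : seq nat) : bool :=
  all (fun n => 0 < n) (behead a) && (cf a == x).

(* The letter 1 is [true], the letter 0 is [false]. *)
Definition word := seq bool.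

(* The partial quotients come in [l] consecutive pairs; the last one is
   decreased by 1. *)
Definition cf_word (l : nat) (a : seq nat) : word :=
  flatten [seq nseq (nth 0 a (2 * i)) true ++
               nseq (nth 0 a (2 * i + 1) - (i.+1 == l)) false | i <- iota 0 l].

Fixpoint theta (w : word) : word :=
  if w is c :: w' then (if odd (size w') then c else ~~ c) :: theta w' else [::].

Definition point : Type := (nat * nat)%type.

(* A unit edge of the square lattice, as the pair of its left (resp. lower)
   and its right (resp. upper) endpoints. *)
Definition edge : Type := (point * point)%type.

Definition horizontal (e : edge) : bool := e.1.2 == e.2.2.
Definition vertical (e : edge) : bool := e.1.1 == e.2.1.
Definition incident (v : point) (e : edge) : bool := (v == e.1) || (v == e.2).

Definition word_point (p : word) : point :=
  (count_mem false p, count_mem true p).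

(* The lower left corners of the unit squares: one for each prefix of [w],
   from the empty word to [w] itself. *)
Definition corner (w : word) (k : 'I_(size w).+1) : point :=
  word_point (take k w).

Definition square_edges (s : point) : {fset edge} :=
  let: (i, j) := s in
  [fset ((i, j), (i.+1, j)); ((i, j), (i, j.+1));
        ((i.+1, j), (i.+1, j.+1)); ((i, j.+1), (i.+1, j.+1))].

Definition square_vertices (s : point) : {fset point} :=
  let: (i, j) := s in [fset (i, j); (i.+1, j); (i, j.+1); (i.+1, j.+1)].

Definition snake_edges (w : word) : {fset edge} :=
  (\bigcup_(k in 'I_(size w).+1) square_edges (corner k))%fset.

Definition snake_vertices (w : word) : {fset point} :=
  (\bigcup_(k in 'I_(size w).+1) square_vertices (corner k))%fset.

Definition boundary_edges (w : word) : {fset edge} :=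
  [fset e in snake_edges w |
    #|[set k : 'I_(size w).+1 | e \in square_edges (corner k)]| == 1].

Definition top_right (w : word) : point :=
  let: (i, j) := word_point w in (i.+1, j.+1).

Definition edges_at (m : {fset edge}) (v : point) : {fset edge} :=
  [fset e in m | incident v e].

Definition perfect_matchings (w : word) : {fset {fset edge}} :=
  [fset m in fpowerset (snake_edges w) |
    all (fun v => #|` edges_at m v| == 1) (snake_vertices w)].

Definition basic_matching (w : word) (b : {fset edge}) : Prop :=
  [/\ b \in perfect_matchings w,
      b `<=` boundary_edges w &
      has vertical (edges_at b (top_right w))].

Definition perp (w : word) (m : {fset edge}) : bool :=
  if odd (size w) then has vertical (edges_at m (0, 0))
  else has horizontal (edges_at m (0, 0)).

Definition perp_matchings (w : word) : {fset {fset edge}} :=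
  [fset m in perfect_matchings w | perp w m].

Definition par_matchings (w : word) : {fset {fset edge}} :=
  [fset m in perfect_matchings w | ~~ perp w m].

Definition symdiff (m b : {fset edge}) : {fset edge} :=
  (m `\` b) `|` (b `\` m).

(* The faces of the plane graph [G(w)] are its unit squares, [Some k], and the
   unbounded face, [None]. *)
Definition face_edges (w : word) (f : option 'I_(size w).+1) : {fset edge} :=
  if f is Some k then square_edges (corner k) else boundary_edges w.

(* One can step from face [f] to face [g] without crossing the curves [D]. *)
Definition face_adj (w : word) (D : {fset edge})
    (f g : option 'I_(size w).+1) : bool :=
  (face_edges f `&` face_edges g) `\` D != fset0.

(* The region enclosed by a union [D] of cycles of [G(w)] consists of the
   bounded connected components of the complement of [D], that is, of the unit
   squares that are not joined to the unbounded face; each has area 1. *)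
Definition area (w : word) (D : {fset edge}) : nat :=
  #|[set k : 'I_(size w).+1 | ~~ connect (face_adj D) None (Some k)]|.

Local Open Scope ring_scope.

Definition Kq : fieldType := {fraction {poly int}}.

Definition q : Kq := tofrac ('X : {poly int}).

Definition mx2 (a b c d : Kq) : 'M[Kq]_2 :=
  \matrix_(i, j) (nth [::] [:: [:: a; b]; [:: c; d]] i)`_j.

Definition col2 (a b : Kq) : 'cV[Kq]_2 := \col_i [:: a; b]`_i.

Definition Rq : 'M[Kq]_2 := mx2 q 1 0 1.
Definition Lq : 'M[Kq]_2 := mx2 q 0 q 1.

(* Main.v *)
Require Import Defs.
From mathcomp Require Import all_boot all_order all_algebra finmap.

Import Order.TTheory GRing.Theory Num.Theory.

Set Implicit Arguments.
Unset Strict Implicit.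
Unset Printing Implicit Defensive.

(* The snake graph of [c :: w'] is a unit square glued to the snake graph of
   [w'] along one edge [e]. A perfect matching of the former is either a
   perfect matching of the latter together with the edge of the new square
   opposite to [e], or a perfect matching of the latter containing [e], with
   [e] replaced by the two sides of the new square that touch [e]. Which of
   the two alternatives encloses the new square, relative to the basic
   matching, is decided by the letter [t] such that [c :: w' = theta (t :: u)].
   Hence matchings are encoded by the boolean sequences recording the enclosed
   squares: [m] and the basic matching differ exactly by the sum modulo 2 of
   the boundaries of these squares, the area is their number, [m] is a
   perp-matching iff the first square is enclosed, and prepending a letter
   acts on the two generating functions by the matrix [Rq] or [Lq], up to
   conjugation by [diag(1, q)]. *)

Local Open Scope fset_scope.
Local Open Scope nat_scope.

(** * Lattice steps and unit squares *)

Definition step (p : point) (c : bool) : point :=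
  if c then (p.1, p.2.+1) else (p.1.+1, p.2).

(** The negation makes [side p c] the edge along which the square at [p] is glued to a predecessor
    that reached [p] by the step [c]. *)
Definition side (p : point) (c : bool) : edge := (p, step p (~~ c)).

Lemma stepC p c d : step (step p c) d = step (step p d) c.
Proof. by case: c d => [] []. Qed.

(** Relative to a step [c], the sides come in the order used for gluing: the one opposite to the
    next square, the one shared with it, then the two joining these. *)
Lemma in_square_edges p c e :
  (e \in square_edges p) =
  [|| e == (p, step p (~~ c)), e == (step p c, step (step p c) (~~ c)),
      e == (p, step p c) | e == (step p (~~ c), step (step p c) (~~ c))].
Proof.
case: p => i j; rewrite !inE -!orbA.
case: c => /=; do ![case: (e == _) => //=].
Qed.

Lemma in_square_vertices p c v :
  (v \in square_vertices p) =
  [|| v == p, v == step p c, v == step p (~~ c) | v == step (step p c) (~~ c)].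
Proof.
case: p => i j; rewrite !inE -!orbA.
case: c => /=; do ![case: (v == _) => //=].
Qed.

(** * Gluing a square to a graph *)

Definition matched (m : {fset edge}) (v : point) : bool := #|` edges_at m v| == 1.

(** Existence and uniqueness are packed into one boolean equation, which serves as a rewriting
    rule. *)
Lemma matchedP m v :
  reflect (exists e, forall e', (e' \in m) && incident v e' = (e' == e)) (matched m v).
Proof.
apply: (iffP (cardfs1P _)) => -[e He]; exists e.
  by move=> e'; move/fsetP/(_ e'): He; rewrite !inE.
by apply/fsetP => e'; rewrite !inE He.
Qed.

Definition is_matching (E : {fset edge}) (V : {fset point}) m :=
  (m `<=` E) && all (matched m) V.

Lemma matchingP E V m :
  reflect ({subset m <= E} /\ {in V, forall v, matched m v}) (is_matching E V m).
Proof.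
apply: (iffP andP) => -[H1 H2]; split.
- exact/fsubsetP.
- by apply/allP.
- exact/fsubsetP.
- by apply/allP.
Qed.

(* The square with sides (p, a), (p, b), (a, d), (b, d) is glued along (a, d)
   to the graph that [m] matches; for [t] false, [m] has to contain (a, d). *)
Definition glue (p a b d : point) (t : bool) (m : {fset edge}) : {fset edge} :=
  if t then (p, b) |` m else (p, a) |` ((b, d) |` (m `\ (a, d))).

Section Glue.
Variables (p a b d : point) (E : {fset edge}) (V : {fset point}).
Hypotheses (pV : p \notin V) (bV : b \notin V) (aV : a \in V) (dV : d \in V).
Hypotheses (pb : p != b) (ad : a != d).
Hypothesis adE : (a, d) \in E.
Hypothesis endsE : forall e, e \in E -> (e.1 \in V) && (e.2 \in V).

Let pa : p != a. Proof. by apply: contraNneq pV => ->. Qed.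
Let pd : p != d. Proof. by apply: contraNneq pV => ->. Qed.
Let ba : b != a. Proof. by apply: contraNneq bV => ->. Qed.
Let bd : b != d. Proof. by apply: contraNneq bV => ->. Qed.

Variables (E1 : {fset edge}) (V1 : {fset point}).
Hypothesis E1E : forall e,
  (e \in E1) = [|| e == (p, b), e == (a, d), e == (p, a), e == (b, d) | e \in E].
Hypothesis V1E : forall v, (v \in V1) = [|| v == p, v == a, v == b, v == d | v \in V].

Let notinE e v : v \notin V -> e \in E -> incident v e = false.
Proof.
move=> vV /endsE/andP[e1 e2]; apply/negbTE; apply: contraNN vV.
by case/orP => /eqP ->.
Qed.

(** The new vertices [p] and [b] lie outside [V], so they meet only new edges. For [t] true,
    [(p, b)] covers both; for [t] false, [a] and [d] trade their common edge for [(p, a)] and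
    [(b, d)]. *)
Lemma glue_matching t m : is_matching E V m -> t || ((a, d) \in m) ->
  is_matching E1 V1 (glue p a b d t m).
Proof.
move=> /matchingP[mE mV] tm; apply/matchingP; split.
  move=> e; rewrite /glue E1E; case: (t); rewrite !inE.
    by case/orP => [->//|/mE ->]; rewrite !orbT.
  by case/or3P => [->|->|/andP[_ /mE ->]]; rewrite ?orbT.
have npb v : v \in V -> incident v (p, b) = false.
  move=> vV; apply/negbTE/negP; rewrite /incident /=.
  by case/orP => /eqP vE; move: vV; rewrite vE ?(negbTE pV) ?(negbTE bV).
move=> v; rewrite V1E => Hv.
have {Hv}[->|[->|vV]] : v = p \/ (v = b \/ v \in V).
  by case/or4P: Hv => [/eqP|/eqP ->|/eqP|/orP[/eqP ->|]]; auto.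
- apply/matchedP; exists (if t then (p, b) else (p, a)) => e.
  rewrite /glue; case: (t); rewrite !inE.
    case: eqP => [->|_] /=; first by rewrite /incident eqxx.
    by apply/andP => -[/mE eE]; rewrite notinE.
  case: (e =P (p, a)) => [->|_] /=; first by rewrite /incident eqxx.
  case: eqP => [->|_] /=; first by rewrite /incident /= (negbTE pb) (negbTE pd).
  by apply/andP => -[/andP[_ /mE eE]]; rewrite notinE.
- apply/matchedP; exists (if t then (p, b) else (b, d)) => e.
  rewrite /glue; case: (t); rewrite !inE.
    case: eqP => [->|_] /=; first by rewrite /incident eqxx orbT.
    by apply/andP => -[/mE eE]; rewrite notinE.
  case: (e =P (p, a)) => [->|_] /=.
    by rewrite /incident /= eq_sym (negbTE pb) (negbTE ba) xpair_eqE (negbTE pb).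
  case: eqP => [->|_] /=; first by rewrite /incident eqxx.
  by apply/andP => -[/andP[_ /mE eE]]; rewrite notinE.
move: (mV v vV) => /matchedP[e0 He0].
case: t tm => [_|/= adm].
  apply/matchedP; exists e0 => e; rewrite /glue !inE -He0.
  case: eqP => [->|_] //=.
  by rewrite (npb _ vV) andbF.
have vp : v != p by apply: contraNneq pV => <-.
have vb : v != b by apply: contraNneq bV => <-.
case: (altP (v =P a)) => [va|nva].
  apply/matchedP; exists (p, a) => e; rewrite /glue !inE.
  case: eqP => [->|_] /=; first by rewrite /incident va eqxx orbT.
  case: eqP => [->|_] /=; first by rewrite /incident /= (negbTE vb) va (negbTE ad).
  have e0E : (a, d) = e0 by apply/eqP; rewrite -He0 adm /incident va eqxx.
  by rewrite -andbA He0 -e0E; case: eqP.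
case: (altP (v =P d)) => [vd|nvd].
  apply/matchedP; exists (b, d) => e; rewrite /glue !inE.
  case: (e =P (p, a)) => [->|_] /=.
    by rewrite /incident /= (negbTE vp) (negbTE nva) xpair_eqE (negbTE pb).
  case: eqP => [->|_] /=; first by rewrite /incident vd eqxx orbT.
  have e0E : (a, d) = e0 by apply/eqP; rewrite -He0 adm /incident vd eqxx orbT.
  by rewrite -andbA He0 -e0E; case: eqP.
apply/matchedP; exists e0 => e; rewrite /glue !inE -He0.
case: (e =P (p, a)) => [->|_] /=.
  by rewrite /incident /= (negbTE vp) (negbTE nva) andbF.
case: eqP => [->|_] /=.
  by rewrite /incident /= (negbTE vb) (negbTE nvd) andbF.
case: eqP => [->|_] //=.
by rewrite /incident /= (negbTE nva) (negbTE nvd) andbF.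
Qed.

(** At [p] the only choices are [(p, b)] and [(p, a)]. Without [(p, b)], both [(p, a)] and [(b, d)]
    are forced; this keeps [(a, d)] out of [m], so it can be put back in their place. *)
Lemma matching_glue m : is_matching E1 V1 m ->
  exists t m', [/\ is_matching E V m', t || ((a, d) \in m') & m = glue p a b d t m'].
Proof.
move=> /matchingP[mE mV].
have uniq_at v e e' : v \in V1 -> e \in m -> incident v e -> e' \in m -> incident v e' -> e' = e.
  move=> vV em ev e'm e'v; have /matchedP[f Hf] := mV v vV.
  have := Hf e; rewrite em ev => /esym/eqP ->.
  by have := Hf e'; rewrite e'm e'v => /esym/eqP ->.
have pV1 : p \in V1 by rewrite V1E eqxx.
have aV1 : a \in V1 by rewrite V1E eqxx orbT.
have bV1 : b \in V1 by rewrite V1E eqxx !orbT.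
have dV1 : d \in V1 by rewrite V1E eqxx !orbT.
have [ep epm epp] : exists2 e, e \in m & incident p e.
  have /matchedP[e He] := mV p pV1; exists e;
  by have := He e; rewrite eqxx => /andP[].
have [eb ebm ebb] : exists2 e, e \in m & incident b e.
  have /matchedP[e He] := mV b bV1; exists e;
  by have := He e; rewrite eqxx => /andP[].
case: (boolP ((p, b) \in m)) => pbm.
  have npa : (p, a) \notin m.
    apply/negP => pam; have := uniq_at p _ _ pV1 pbm _ pam.
    by rewrite /incident !eqxx => /(_ isT isT) [/eqP]; rewrite eq_sym (negbTE ba).
  have nbd : (b, d) \notin m.
    apply/negP => bdm; have := uniq_at b _ _ bV1 pbm _ bdm.
    by rewrite /incident !eqxx orbT => /(_ isT isT) [/eqP]; rewrite eq_sym (negbTE pb).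
  exists true, (m `\ (p, b)); split=> //; last by rewrite /glue fsetD1K.
  apply/matchingP; split.
    move=> e; rewrite !inE => /andP[/negbTE ne em].
    have := mE e em; rewrite E1E ne /=; case/or4P => // /eqP ee; first by rewrite ee.
      by move: em; rewrite ee (negbTE npa).
    by move: em; rewrite ee (negbTE nbd).
  move=> v vV; have /matchedP[e He] : matched m v by apply: mV; rewrite V1E vV !orbT.
  apply/matchedP; exists e => e'; rewrite !inE -He; case: eqP => //= ->.
  rewrite /incident /=; apply/esym/negbTE; rewrite negb_and negb_or; apply/orP; right.
  by apply/andP; split; [apply: contraNneq pV|apply: contraNneq bV] => <-.
have pam : (p, a) \in m.
  have := mE _ epm; rewrite E1E; case/or4P => [/eqP ee|/eqP ee|/eqP ee|/orP[/eqP ee|eE]].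
  - by move: epm pbm; rewrite ee => ->.
  - by move: epp; rewrite ee /incident /= (negbTE pa) (negbTE pd).
  - by rewrite -ee.
  - by move: epp; rewrite ee /incident /= (negbTE pb) (negbTE pd).
  - by move: epp; rewrite notinE.
have bdm : (b, d) \in m.
  have := mE _ ebm; rewrite E1E; case/or4P => [/eqP ee|/eqP ee|/eqP ee|/orP[/eqP ee|eE]].
  - by move: ebm pbm; rewrite ee => ->.
  - by move: ebb; rewrite ee /incident /= (negbTE ba) (negbTE bd).
  - by move: ebb; rewrite ee /incident /= eq_sym (negbTE pb) (negbTE ba).
  - by rewrite -ee.
  - by move: ebb; rewrite notinE.
have nad : (a, d) \notin m.
  apply/negP => adm; have := uniq_at a _ _ aV1 pam _ adm.
  by rewrite /incident !eqxx orbT => /(_ isT isT) [/eqP]; rewrite eq_sym (negbTE pa).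
exists false, ((a, d) |` (m `\ (p, a) `\ (b, d))); split.
- apply/matchingP; split.
    move=> e; rewrite !inE => /orP[/eqP -> //|/and3P[/negbTE n1 /negbTE n2 em]].
    have := mE e em; rewrite E1E n1 n2 /=; case/or3P => // /eqP ee; last by rewrite ee.
    by move: em; rewrite ee (negbTE pbm).
  move=> v vV.
  have vV1 : v \in V1 by rewrite V1E vV !orbT.
  have vp : v != p by apply: contraNneq pV => <-.
  have vb : v != b by apply: contraNneq bV => <-.
  have /matchedP[e He] := mV v vV1.
  case: (altP (v =P a)) => [va|nva].
    apply/matchedP; exists (a, d) => e'; rewrite !inE.
    case: eqP => [->|_] /=; first by rewrite /incident va eqxx.
    rewrite -andbA; case: eqP => //= _; rewrite -andbA He; apply/andP => -[n1 /eqP n2].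
    have n3 : (p, a) = e by apply/eqP; rewrite -He pam /incident va eqxx orbT.
    by rewrite n2 -n3 eqxx in n1.
  case: (altP (v =P d)) => [vd|nvd].
    apply/matchedP; exists (a, d) => e'; rewrite !inE.
    case: eqP => [->|_] /=; first by rewrite /incident vd eqxx orbT.
    rewrite -!andbA He; apply/and3P => -[n1 _ /eqP n2].
    have n3 : (b, d) = e by apply/eqP; rewrite -He bdm /incident vd eqxx orbT.
    by rewrite n2 -n3 eqxx in n1.
  apply/matchedP; exists e => e'; rewrite !inE -He.
  case: (e' =P (a, d)) => [->|_] /=.
    by rewrite /incident /= (negbTE nva) (negbTE nvd) andbF.
  case: eqP => [->|_] /=.
    by rewrite /incident /= (negbTE vb) (negbTE nvd) andbF.
  case: eqP => [->|_] //=.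
  by rewrite /incident /= (negbTE vp) (negbTE nva) andbF.
- by rewrite !inE eqxx.
apply/fsetP => e; rewrite /glue !inE.
case: (e =P (p, a)) => [->|_] //=.
case: (e =P (b, d)) => [->|_] //=.
by case: (e =P (a, d)) => [->|_] //=; apply/negbTE.
Qed.

End Glue.

(** * Matchings of snake graphs *)

(** The base point is a parameter so that induction on the word can move it. *)
Fixpoint corners (p : point) (w : word) : seq point :=
  p :: (if w is c :: w' then corners (step p c) w' else [::]).

Definition edges_of (p : point) (w : word) : {fset edge} :=
  \bigcup_(s <- corners p w) square_edges s.

Definition vertices_of (p : point) (w : word) : {fset point} :=
  \bigcup_(s <- corners p w) square_vertices s.

Lemma edges_ofP p w e :
  reflect (exists2 s, s \in corners p w & e \in square_edges s) (e \in edges_of p w).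
Proof.
apply: (iffP (bigfcupP _ _ _ _)) => -[s sw es]; exists s => //.
  by rewrite andbT in sw.
by rewrite sw.
Qed.

Lemma vertices_ofP p w v :
  reflect (exists2 s, s \in corners p w & v \in square_vertices s) (v \in vertices_of p w).
Proof.
apply: (iffP (bigfcupP _ _ _ _)) => -[s sw es]; exists s => //.
  by rewrite andbT in sw.
by rewrite sw.
Qed.

Lemma mem_edges_cons p c w e :
  (e \in edges_of p (c :: w)) = (e \in square_edges p) || (e \in edges_of (step p c) w).
Proof. by rewrite /edges_of big_cons inE. Qed.

Lemma mem_vertices_cons p c w v :
  (v \in vertices_of p (c :: w)) =
  (v \in square_vertices p) || (v \in vertices_of (step p c) w).
Proof. by rewrite /vertices_of big_cons inE. Qed.

Lemma mem_edges_nil p e : (e \in edges_of p [::]) = (e \in square_edges p).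
Proof. by rewrite /edges_of big_cons big_nil inE in_fset0 orbF. Qed.

Lemma mem_vertices_nil p v : (v \in vertices_of p [::]) = (v \in square_vertices p).
Proof. by rewrite /vertices_of big_cons big_nil inE in_fset0 orbF. Qed.

Lemma corners_first p w : p \in corners p w.
Proof. by case: w => [|c w]; rewrite inE eqxx. Qed.

Lemma corners_ge p w s : s \in corners p w -> p.1 <= s.1 /\ p.2 <= s.2.
Proof.
elim: w p => [|c w IH] p; rewrite inE; first by move=> /eqP ->.
case/orP => [/eqP -> //|/IH []]; case: c => /= H1 H2; split=> //; exact: ltnW.
Qed.

Lemma vertices_ge p w v : v \in vertices_of p w -> p.1 <= v.1 /\ p.2 <= v.2.
Proof.
case/vertices_ofP => s /corners_ge [H1 H2]; rewrite (in_square_vertices s false).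
by case/or4P => /eqP -> /=; split=> //; apply: (leq_trans _ (leqnSn _)).
Qed.

Lemma edge_ends p w e : e \in edges_of p w ->
  (e.1 \in vertices_of p w) && (e.2 \in vertices_of p w).
Proof.
case/edges_ofP => s sw; rewrite (in_square_edges s false) => es.
by apply/andP; split; apply/vertices_ofP; exists s => //;
   rewrite (in_square_vertices s false); case/or4P: es => /eqP -> /=; rewrite eqxx ?orbT.
Qed.

(** The step [c] raises one coordinate; [p] and [step p (~~ c)] keep its old value, and no vertex of
    the remaining snake falls below the new one. *)
Lemma origin_notin p c w : p \notin vertices_of (step p c) w.
Proof.
by apply/negP => /vertices_ge []; case: c => /= H1 H2; [move: H2|move: H1]; rewrite ltnn.
Qed.

Lemma turn_notin p c w : step p (~~ c) \notin vertices_of (step p c) w.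
Proof.
by apply/negP => /vertices_ge []; case: c => /= H1 H2; [move: H2|move: H1]; rewrite ltnn.
Qed.

Lemma step_neq p c : (p == step p c) = false.
Proof.
apply/negbTE/eqP => /(congr1 (fun v : point => v.1 + v.2)) /eqP.
by case: c => /=; rewrite ?addSn ?addnS eqn_leq ltnn andbF.
Qed.

Lemma step_inj p : injective (step p).
Proof.
by case: p => i j [] [] //= [] /eqP; rewrite 1?eq_sym eqn_leq ltnn ?andbF.
Qed.

Lemma mem_first_edges p c w : (step p c, step (step p c) (~~ c)) \in edges_of (step p c) w.
Proof.
apply/edges_ofP; exists (step p c); first exact: corners_first.
by rewrite (in_square_edges _ c) eqxx.
Qed.

(** * Encoding of matchings by bit sequences *)

Definition glue_square (p : point) (c : bool) : bool -> {fset edge} -> {fset edge} :=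
  glue p (step p c) (step p (~~ c)) (step (step p c) (~~ c)).

(* Entry [k] of [s] tells whether square [k] is enclosed by the symmetric
   difference with the basic matching. The letter 0 or 1 that [theta] turns
   into [c] is [c == odd (size w')]. A single square is seen as a square glued
   along its top edge to the graph reduced to that edge. *)
Fixpoint snake_matching (p : point) (w : word) (s : seq bool) : {fset edge} :=
  match w with
  | [::] => glue_square p true (head true s)
              [fset (step p true, step (step p true) (~~ true))]
  | c :: w' => glue_square p c (head true s == (c == odd (size w')))
                 (snake_matching (step p c) w' (behead s))
  end.

(** Indicator sequences of the order ideals of a fence poset: the only excluded pair of consecutive
    bits is [~~ t] followed by [t], so each letter orients one relation of the poset. *)
Fixpoint fence (w : word) : seq (seq bool) :=
  if w is c :: w' then
    let t := c == odd (size w') in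
    [seq t :: s | s <- fence w'] ++
    [seq ~~ t :: s | s <- [seq s <- fence w' | head true s == ~~ t]]
  else [:: [:: true]; [:: false]].

Lemma mem_fence_cons c w s :
  reflect (exists x s', [/\ s = x :: s', s' \in fence w &
                            (x == (c == odd (size w))) || (head true s' == x)])
          (s \in fence (c :: w)).
Proof.
rewrite /= mem_cat; set t := c == _; apply: (iffP orP) => [[]|].
- by case/mapP => s' s'w ->; exists t, s'; rewrite eqxx.
- case/mapP => s'; rewrite mem_filter => /andP[/eqP s't s'w] ->.
  by exists (~~ t), s'; rewrite s't eqxx orbT.
- case=> x [s'] [-> s'w]; case: eqP => [-> _|/eqP xt /= /eqP s'x].
    by left; apply: map_f.
  have -> : x = ~~ t by case: (x) (t) xt => [] [].
  right; apply: map_f; rewrite mem_filter s'w s'x andbT.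
  by case: (x) (t) xt => [] [].
Qed.

Lemma fence_size w s : s \in fence w -> size s = (size w).+1.
Proof.
elim: w s => [|c w IH] s; first by rewrite !inE => /orP[] /eqP ->.
by case/mem_fence_cons => x [s'] [-> /IH /= -> _].
Qed.

Lemma fence_uniq w : uniq (fence w).
Proof.
elim: w => [//|c w IH] /=; set t := c == _.
rewrite cat_uniq !map_inj_uniq ?filter_uniq ?IH ?andbT //=; try by move=> ? ? [].
by apply/hasPn => s /mapP[s' _ ->]; apply/mapP => -[s''] _ []; case: (t).
Qed.

Lemma fence_nseq w : nseq (size w).+1 false \in fence w.
Proof.
elim: w => [|c w IH]; first by rewrite !inE.
by apply/mem_fence_cons; exists false, (nseq (size w).+1 false); rewrite orbT.
Qed.

Lemma is_matching_edge (a d : point) m : a != d ->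
  is_matching [fset (a, d)] [fset a; d] m = (m == [fset (a, d)]).
Proof.
move=> ad; apply/matchingP/eqP => [[mE mV]|->].
  have /matchedP[e He] : matched m a by apply: mV; rewrite !inE eqxx.
  have := He e; rewrite eqxx => /andP[em _].
  apply/fsetP => e'; apply/idP/idP => [/mE//|].
  by rewrite inE => /eqP ->; have := mE _ em; rewrite inE => /eqP <-.
split=> // v; rewrite !inE => vad; apply/matchedP; exists (a, d) => e'.
rewrite !inE; case: eqP => //= ->; exact: vad.
Qed.

Section GlueStep.
Variables (p : point) (c : bool) (w : word).
Let a := step p c.
Let b := step p (~~ c).
Let d := step (step p c) (~~ c).

Lemma glue_matching_cons t m : is_matching (edges_of a w) (vertices_of a w) m ->
  t || ((a, d) \in m) ->
  is_matching (edges_of p (c :: w)) (vertices_of p (c :: w)) (glue_square p c t m).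
Proof.
have /andP[/= aV dV] := edge_ends (mem_first_edges p c w).
apply: glue_matching => //.
- exact: origin_notin.
- exact: turn_notin.
- by rewrite step_neq.
- by rewrite /d step_neq.
- exact: edge_ends.
- by move=> e; rewrite mem_edges_cons (in_square_edges p c) -!orbA.
- by move=> v; rewrite mem_vertices_cons (in_square_vertices p c) -!orbA.
Qed.

Lemma matching_glue_cons m :
  is_matching (edges_of p (c :: w)) (vertices_of p (c :: w)) m ->
  exists t m', [/\ is_matching (edges_of a w) (vertices_of a w) m',
                   t || ((a, d) \in m') & m = glue_square p c t m'].
Proof.
have /andP[/= aV dV] := edge_ends (mem_first_edges p c w).
apply: matching_glue => //.
- exact: origin_notin.
- exact: turn_notin.
- by rewrite step_neq.
- exact: mem_first_edges.
- exact: edge_ends.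
- by move=> e; rewrite mem_edges_cons (in_square_edges p c) -!orbA.
- by move=> v; rewrite mem_vertices_cons (in_square_vertices p c) -!orbA.
Qed.

End GlueStep.

Section GlueNil.
Variable (p : point).
Let a := step p true.
Let b := step p false.
Let d := step (step p true) false.

Let adV v : v \in [fset a; d] -> v \in vertices_of a [::].
Proof.
rewrite mem_vertices_nil (in_square_vertices a false) !inE.
by case/orP => ->; rewrite ?orbT.
Qed.

Let pV : p \notin [fset a; d].
Proof. by apply: contra (@adV p) _; exact: (origin_notin p true). Qed.

Let bV : b \notin [fset a; d].
Proof. by apply: contra (@adV b) _; exact: (turn_notin p true). Qed.

Let endsE : forall e, e \in [fset (a, d)] -> (e.1 \in [fset a; d]) && (e.2 \in [fset a; d]).
Proof. by move=> e; rewrite inE => /eqP ->; rewrite !inE !eqxx orbT. Qed.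

Let E1E e : (e \in edges_of p [::]) =
  [|| e == (p, b), e == (a, d), e == (p, a), e == (b, d) | e \in [fset (a, d)]].
Proof.
rewrite mem_edges_nil (in_square_edges p true) inE.
by do ![case: (e == _) => //=].
Qed.

Let V1E v : (v \in vertices_of p [::]) =
  [|| v == p, v == a, v == b, v == d | v \in [fset a; d]].
Proof.
rewrite mem_vertices_nil (in_square_vertices p true) !inE.
by do ![case: (v == _) => //=].
Qed.

Lemma matching_nil m : is_matching (edges_of p [::]) (vertices_of p [::]) m <->
  exists t, m = glue_square p true t [fset (a, d)].
Proof.
have pb : p != b by rewrite step_neq.
have ad : a != d by rewrite step_neq.
have adE : (a, d) \in [fset (a, d)] by rewrite inE.
have /andP[/= aV dV] := endsE adE.
split=> [mm|[t ->]].
  have [t [m' [m'm _ ->]]] := matching_glue pV bV aV dV pb adE endsE E1E V1E mm.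
  by move: m'm; rewrite is_matching_edge // => /eqP ->; exists t.
apply: (glue_matching pV bV aV dV pb ad endsE E1E V1E).
  by rewrite is_matching_edge.
by rewrite inE eqxx orbT.
Qed.

End GlueNil.

Section GlueMem.
Variables (p : point) (c : bool) (m : {fset edge}).
Hypothesis pm : forall e, e \in m -> (e.1 != p) && (e.1 != step p (~~ c)).

Lemma side_glue t e : (side p e \in glue_square p c t m) = (t == (e == c)).
Proof.
have pN v : ((p, v) \in m) = false by apply/negP => /pm; rewrite eqxx.
rewrite /side /glue_square /glue.
have [->|/eqP ec] := e =P c; last first.
  have -> : e = ~~ c by case: (e) (c) ec => [] [].
  case: t; rewrite negbK !inE pN !xpair_eqE ?eqxx ?orbF //=.
  by apply/eqP => /step_inj; case: (c).
case: t; rewrite !inE pN !xpair_eqE ?eqxx ?orbF //= step_neq /= andbF orbF.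
by apply/eqP => /step_inj; case: (c).
Qed.

(** The two alternatives of [glue] differ by the whole boundary of the new square. Writing them as
    sums modulo 2 lets common terms cancel in symmetric differences. *)
Lemma mem_glue t e : t || ((step p c, step (step p c) (~~ c)) \in m) ->
  (e \in glue_square p c t m) =
  (e \in m) (+) (e == (p, step p (~~ c))) (+) (~~ t && (e \in square_edges p)).
Proof.
have pN v : ((p, v) \in m) = false by apply/negP => /pm; rewrite eqxx.
have bN v : ((step p (~~ c), v) \in m) = false.
  by apply/negP => /pm; rewrite eqxx andbF.
have ab : (step p c == step p (~~ c)) = false by apply/eqP => /step_inj; case: (c).
rewrite (in_square_edges p c) /glue_square /glue; case: t => [_|/= adm] /=.
  by rewrite !inE addbF; case: eqP => [->|_]; rewrite ?pN ?addbF.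
rewrite !inE.
case: (e =P (p, step p c)) => [->|_] /=; first by rewrite pN !xpair_eqE ab andbF ?orbT.
case: (e =P (step p (~~ c), _)) => [->|_] /=.
  by rewrite bN !xpair_eqE !orbT eq_sym step_neq.
case: (e =P (p, step p (~~ c))) => [->|_] /=.
  by rewrite pN !xpair_eqE step_neq.
case: (e =P (step p c, _)) => [->|_] /=; first by rewrite adm.
by rewrite !addbF.
Qed.

End GlueMem.

Lemma sub_edges_start p c w (m : {fset edge}) e : {subset m <= edges_of (step p c) w} ->
  e \in m -> (e.1 != p) && (e.1 != step p (~~ c)).
Proof.
move=> mE /mE /edge_ends/andP[eV _].
by apply/andP; split; apply: contraTneq eV => ->; rewrite (origin_notin, turn_notin).
Qed.

Lemma sub_first_edge p :
  {subset [fset (step p true, step (step p true) false)] <= edges_of (step p true) [::]}.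
Proof. by move=> e; rewrite inE => /eqP ->; exact: (mem_first_edges p true). Qed.

(** The second conjunct strengthens the induction: it decides whether the edge shared with a
    preceding square is in the matching, which is what gluing with [t] false requires. *)
Lemma snake_matchingP p w s : s \in fence w ->
  is_matching (edges_of p w) (vertices_of p w) (snake_matching p w s) /\
  forall d, (side p d \in snake_matching p w s) = (head true s == d (+) odd (size w)).
Proof.
elim: w p s => [|c w IH] p s.
  move=> _; split; first by apply/matching_nil; exists (head true s).
  move=> d; rewrite /= side_glue; first by case: d.
  move=> e; exact: sub_edges_start (@sub_first_edge p).
case/mem_fence_cons => x [s'] [-> s'w xs'] /=.
have [mm sm] := IH (step p c) s' s'w.
have /matchingP[mE _] := mm.
split=> [|d].
  apply: glue_matching_cons => //.
  have -> : (step p c, step (step p c) (~~ c)) = side (step p c) c by [].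
  rewrite sm; case: (x) (c) (odd _) (head _ _) xs' => [] [] [] [] //.
rewrite side_glue; last by move=> e; exact: sub_edges_start mE.
by case: (x) (c) (odd _) (d) => [] [] [] [].
Qed.

Lemma snake_matching_onto p w m : is_matching (edges_of p w) (vertices_of p w) m ->
  exists2 s, s \in fence w & m = snake_matching p w s.
Proof.
elim: w p m => [|c w IH] p m.
  by case/matching_nil => t ->; exists [:: t] => //; rewrite !inE; case: (t).
case/matching_glue_cons => t [m' [/IH [s sw ->] tm ->]].
(* The bit is chosen so that comparing it with the letter [c == odd (size w)] returns [t]. *)
exists ((t == (c == odd (size w))) :: s); last first.
  by rewrite /=; congr glue_square; case: (t) (c) (odd _) => [] [] [].
apply/mem_fence_cons; exists (t == (c == odd (size w))), s; split=> //.
have [_ sm] := snake_matchingP (step p c) sw; have := sm c; rewrite /side => smc.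
move: tm; rewrite smc.
by case: (t) (c) (odd _) (head _ _) => [] [] [] [].
Qed.

Lemma addb_middle_cancel a b c d f g : a (+) d = g ->
  (a (+) b (+) c) (+) (d (+) b (+) f) = (c (+) f) (+) g.
Proof. by move=> <-; case: a b c d f => [] [] [] [] []. Qed.

(** By [mem_glue], the edge added in both matchings cancels at each gluing, and the boundary of the
    square survives exactly when the two bits differ. *)
Lemma snake_matching_addb p w s t e : s \in fence w -> t \in fence w ->
  (e \in snake_matching p w s) (+) (e \in snake_matching p w t) =
  \big[addb/false]_(i < (size w).+1)
    ((nth false s i (+) nth false t i) && (e \in square_edges (nth (0, 0) (corners p w) i))).
Proof.
elim: w p s t => [|c w IH] p s t.
  rewrite big_ord1 !inE => sw tw.
  have ok u : u || ((step p true, step (step p true) (~~ true)) \in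
                    [fset (step p true, step (step p true) (~~ true))]).
    by rewrite inE eqxx orbT.
  rewrite /= !mem_glue //; try by move=> ?; exact: sub_edges_start (@sub_first_edge p).
  rewrite (addb_middle_cancel _ _ _ (addbb _)) // addbF.
  by case/orP: sw => /eqP ->; case/orP: tw => /eqP -> /=; case: (e \in square_edges _).
case/mem_fence_cons => x [s'] [-> s'w xs']; case/mem_fence_cons => y [t'] [-> t'w yt'].
have [/matchingP[sE _] sm] := snake_matchingP (step p c) s'w.
have [/matchingP[tE _] tm] := snake_matchingP (step p c) t'w.
rewrite big_ord_recl /= !mem_glue.
- rewrite (addb_middle_cancel _ _ _ (IH _ _ _ s'w t'w)) //; congr (_ (+) _).
  by case: (x) (y) (c) (odd _) (e \in square_edges _) => [] [] [] [] [].
- move=> ?; exact: sub_edges_start tE.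
- move: (tm c); rewrite /side => ->; by case: (y) (c) (odd _) (head _ _) yt' => [] [] [] [].
- move=> ?; exact: sub_edges_start sE.
- move: (sm c); rewrite /side => ->; by case: (x) (c) (odd _) (head _ _) xs' => [] [] [] [].
Qed.

(** * Area *)

Lemma corners_size p w : size (corners p w) = (size w).+1.
Proof. by elim: w p => [|c w IH] p //=; rewrite IH. Qed.

Lemma nth_corners p w k : k <= size w ->
  nth (0, 0) (corners p w) k =
  (p.1 + count_mem false (take k w), p.2 + count_mem true (take k w)).
Proof.
elim: w p k => [|c w IH] p [|k] //=; rewrite ?addn0 -?surjective_pairing // => kw.
by rewrite IH //; case: c; rewrite /= !add0n !add1n ?addSn !addnS.
Qed.

Lemma nth_corner w (k : 'I_(size w).+1) : nth (0, 0) (corners (0, 0) w) k = corner k.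
Proof. by rewrite nth_corners ?add0n // -ltnS. Qed.

Lemma corners_enum w : corners (0, 0) w = [seq corner k | k <- enum 'I_(size w).+1].
Proof.
rewrite -[LHS](mkseq_nth (0, 0)) /mkseq corners_size -val_enum_ord -map_comp.
by apply: eq_map => k /=; rewrite nth_corner.
Qed.

Lemma cornersP w s :
  reflect (exists k : 'I_(size w).+1, s = corner k) (s \in corners (0, 0) w).
Proof.
rewrite corners_enum; apply: (iffP mapP) => [[k _ ->]|[k ->]]; exists k => //.
by rewrite mem_enum.
Qed.

Lemma snake_edgesE w : snake_edges w = edges_of (0, 0) w.
Proof.
apply/fsetP => e; apply/bigfcupP/edges_ofP => -[s].
  by move=> _ es; exists (corner s) => //; apply/cornersP; exists s.
by case/cornersP => k -> ek; exists k; rewrite ?mem_index_enum.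
Qed.

Lemma snake_verticesE w : snake_vertices w = vertices_of (0, 0) w.
Proof.
apply/fsetP => e; apply/bigfcupP/vertices_ofP => -[s].
  by move=> _ es; exists (corner s) => //; apply/cornersP; exists s.
by case/cornersP => k -> ek; exists k; rewrite ?mem_index_enum.
Qed.

Lemma perfect_matchingsE w m :
  (m \in perfect_matchings w) =
  is_matching (edges_of (0, 0) w) (vertices_of (0, 0) w) m.
Proof. by rewrite !inE /= fpowersetE snake_edgesE snake_verticesE. Qed.

(** Every letter raises the coordinate sum by one; hence each antidiagonal carries at most one
    square of the snake. *)
Lemma corner_rank w (k : 'I_(size w).+1) : (corner k).1 + (corner k).2 = k.
Proof.
rewrite /corner /word_point /=.
have -> : count_mem true (take k w) = count (predC (pred1 false)) (take k w).
  by apply: eq_count => -[].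
by rewrite count_predC size_takel // -ltnS.
Qed.

Lemma corner_inj w : injective (@corner w).
Proof. by move=> i j ij; apply/val_inj; rewrite /= -!corner_rank ij. Qed.

(** An edge borders only two squares of the lattice. On the axes the truncated predecessor merely
    yields the first of them again. *)
Lemma square_of_edge e s : e \in square_edges s ->
  s = e.1 \/ s = if horizontal e then (e.1.1, e.1.2.-1) else (e.1.1.-1, e.1.2).
Proof.
case: s => i j; rewrite !inE -!orbA /horizontal.
by case/or4P => /eqP -> /=; rewrite ?eqxx; auto; right;
   rewrite -?(eq_sym j.+1) eqn_leq ?ltnn ?andbF.
Qed.

Lemma mem_boundary_edges w e : (e \in boundary_edges w) =
  (e \in snake_edges w) &&
  (#|[set k : 'I_(size w).+1 | e \in square_edges (corner k)]| == 1).
Proof. by rewrite in_fset. Qed.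

(** Pigeonhole on the two candidates of [square_of_edge], with [corner] injective. *)
Lemma two_squares w (i j k : 'I_(size w).+1) e : i != j ->
  e \in square_edges (corner i) -> e \in square_edges (corner j) ->
  e \in square_edges (corner k) -> (k == i) || (k == j).
Proof.
move=> ij /square_of_edge ei /square_of_edge ej /square_of_edge ek.
case: ei ej ek => ei [] ej [] ek;
  rewrite -!(inj_eq (@corner_inj w)) ei ej ek ?eqxx ?orbT //;
  by move: ij; rewrite -(inj_eq (@corner_inj w)) ei ej eqxx.
Qed.

Section Area.
Variables (w : word) (D : {fset edge}) (s : seq bool).
Hypothesis D_E : forall e, (e \in D) =
  \big[addb/false]_(k < (size w).+1) (nth false s k && (e \in square_edges (corner k))).

(** At a boundary edge a single term of the sum [D_E] can be nonzero; at an inner edge, treated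
    next, two can. So [D] runs exactly between faces with different bits. *)
Lemma mem_boundary_edge (k : 'I_(size w).+1) e : e \in boundary_edges w ->
  e \in square_edges (corner k) -> (e \in D) = nth false s k.
Proof.
rewrite mem_boundary_edges => /andP[_ /cards1P[j jE]] ek.
have others i : e \in square_edges (corner i) -> i = j.
  by move=> ei; apply/set1P; rewrite -jE in_set.
rewrite D_E (bigD1 k) //= ek andbT big1 ?addbF // => i ik.
by apply/negbTE/negP => /andP[_ /others ij]; rewrite ij (others _ ek) eqxx in ik.
Qed.

Lemma mem_inner_edge (i j : 'I_(size w).+1) e : i != j -> e \in square_edges (corner i) ->
  e \in square_edges (corner j) -> (e \in D) = nth false s i (+) nth false s j.
Proof.
move=> ij ei ej; rewrite D_E (bigD1 i) //= (bigD1 j) 1?eq_sym //= ei ej !andbT.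
rewrite big1 ?addbF // => k /andP[ki kj]; apply/negbTE/negP => /andP[_ ek].
by have := two_squares ij ei ej ek; rewrite (negbTE ki) (negbTE kj).
Qed.

End Area.

(* The only other squares containing the bottom or the left side of square [k]
   have rank [k - 1], and there is only one such corner in the snake. *)
Lemma square_boundary_edge w (k : 'I_(size w).+1) :
  exists2 e, e \in boundary_edges w & e \in square_edges (corner k).
Proof.
have [sE sF] : side (corner k) true \in square_edges (corner k) /\
               side (corner k) false \in square_edges (corner k).
  by split; rewrite (in_square_edges _ false) eqxx ?orbT.
have esn c : side (corner k) c \in snake_edges w.
  by rewrite snake_edgesE; apply/edges_ofP; exists (corner k);
     [apply/cornersP; exists k | case: c].
have bnd c : (forall i, i != k -> side (corner k) c \notin square_edges (corner i)) ->
             side (corner k) c \in boundary_edges w.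
  move=> H; rewrite mem_boundary_edges esn /=; apply/cards1P; exists k; apply/setP => i.
  rewrite in_set in_set1; case: eqP => [->|/eqP/H/negbTE //]; by case: (c).
case: (boolP [forall i, (i != k) ==> (side (corner k) true \notin square_edges (corner i))]).
  move/forallP => H; exists (side (corner k) true) => //.
  by apply: bnd => i ik; apply: (implyP (H i)).
case/forallPn => i; rewrite negb_imply negbK => /andP[ik ei].
exists (side (corner k) false) => //; apply: bnd => j jk; apply/negP => ej.
have ck (u : 'I_(size w).+1) : u != k -> corner u <> corner k.
  by move=> /eqP uk /(@corner_inj w).
have {ei} ei : corner i = ((corner k).1, (corner k).2.-1).
  have [|->] := square_of_edge ei; first by move/(ck _ ik).
  by rewrite /horizontal eqxx.
have {ej} ej : corner j = ((corner k).1.-1, (corner k).2).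
  have [|->] := square_of_edge ej; first by move/(ck _ jk).
  by rewrite /horizontal /= eqn_leq ltnn andbF.
(* Both ranks are one less than that of [k]: the coordinate being decreased is positive, since
   otherwise [corner i] or [corner j] would be [corner k], against [ck]. *)
have ij : i = j.
  apply/val_inj; rewrite /= -!corner_rank ei ej.
  move: (ck _ ik) (ck _ jk); rewrite ei ej.
  by case: (corner k) => [[|x] [|y]] //= H1 H2; rewrite ?addSn ?addnS.
move: (ck _ ik) ei; rewrite ij ej; case: (corner k) => [[|x] y] //= _ [] /eqP.
by rewrite eqn_leq ltnn andbF.
Qed.

Lemma cardset_count n (P : pred 'I_n) : #|[set k | P k]| = count P (enum 'I_n).
Proof.
rewrite cardsE cardE /enum_mem !size_filter count_filter.
by apply: eq_count => k; rewrite /= andbT.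
Qed.

(** Bits are invariant under [face_adj], so squares with bit true are cut off from the outside. A
    square with bit false reaches it in one step, through a boundary edge, which every square of a
    snake has. *)
Lemma area_count w (D : {fset edge}) s : size s = (size w).+1 ->
  (forall e, (e \in D) = \big[addb/false]_(k < (size w).+1)
     (nth false s k && (e \in square_edges (corner k)))) ->
  area w D = count id s.
Proof.
move=> sw D_E.
(* The unbounded face gets the bit false. *)
pose inside (f : option 'I_(size w).+1) := if f is Some k then nth false s k else false.
have inside_adj (f g : option 'I_(size w).+1) : face_adj D f g -> inside f = inside g.
  case/fset0Pn => e; rewrite in_fsetD in_fsetI => /and3P[eD].
  case: f g => [i|] [j|] //= ei ej.
  - have [-> //|ij] := eqVneq i j.
    by move: eD; rewrite (mem_inner_edge D_E ij ei ej) negb_add => /eqP.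
  - by move: eD; rewrite (mem_boundary_edge D_E ej ei) => /negbTE.
  - by move: eD; rewrite (mem_boundary_edge D_E ei ej) => /negbTE.
have conn k : connect (face_adj D) None (Some k) = ~~ inside (Some k).
  apply/idP/idP => [|ik].
    case/connectP => r rp rE.
    have : inside None = inside (last None r).
      elim: r None rp {rE} => [//|f r IH] g /= /andP[gf fr].
      by rewrite (inside_adj _ _ gf) IH.
    by rewrite -rE => <-.
  apply: connect1; have [e eb ek] := square_boundary_edge k.
  by apply/fset0Pn; exists e; rewrite in_fsetD (mem_boundary_edge D_E eb ek) in_fsetI eb ek ik.
rewrite /area cardset_count.
rewrite -[in RHS](mkseq_nth false s) /mkseq count_map sw -val_enum_ord count_map.
by apply: eq_count => k; rewrite /= conn negbK.
Qed.

(** * The basic matching *)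

Lemma mem_edges_at (m : {fset edge}) v e : (e \in edges_at m v) = (e \in m) && incident v e.
Proof. by rewrite in_fset. Qed.

Lemma mem_symdiff (m b : {fset edge}) e : (e \in symdiff m b) = (e \in m) (+) (e \in b).
Proof. by rewrite in_fsetU !in_fsetD; do 2![case: (e \in _)]. Qed.

Definition zeros (w : word) : seq bool := nseq (size w).+1 false.

Lemma symdiff_zeros w s e : s \in fence w ->
  (e \in symdiff (snake_matching (0, 0) w s) (snake_matching (0, 0) w (zeros w))) =
  \big[addb/false]_(k < (size w).+1) (nth false s k && (e \in square_edges (corner k))).
Proof.
move=> sw; rewrite mem_symdiff snake_matching_addb ?fence_nseq //.
by apply: eq_bigr => k _; rewrite nth_nseq if_same addbF nth_corner.
Qed.

Lemma area_snake_matching w s : s \in fence w ->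
  area w (symdiff (snake_matching (0, 0) w s) (snake_matching (0, 0) w (zeros w))) =
  count id s.
Proof.
by move=> sw; apply: area_count => [|e]; rewrite ?symdiff_zeros // (fence_size sw).
Qed.

(** Bit [k] can be read off the matching: it tells whether a boundary edge of square [k] lies in the
    difference with the basic matching. *)
Lemma snake_matching_inj w :
  {in fence w &, injective (snake_matching (0, 0) w)}.
Proof.
move=> s t sw tw st.
apply: (@eq_from_nth _ false) => [|k]; rewrite (fence_size sw) ?(fence_size tw) // => kw.
have [e eb ek] := square_boundary_edge (Ordinal kw).
rewrite -[k]/(val (Ordinal kw)).
rewrite -(mem_boundary_edge (fun e => symdiff_zeros e sw) eb ek).
by rewrite -(mem_boundary_edge (fun e => symdiff_zeros e tw) eb ek) st.
Qed.

Lemma edge_at_origin w e : e \in edges_of (0, 0) w -> incident (0, 0) e ->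
  (vertical e -> e = side (0, 0) false) /\ (horizontal e -> e = side (0, 0) true).
Proof.
case/edges_ofP => -[i j] _; rewrite (in_square_edges _ false) /incident /vertical /horizontal.
by case/or4P => /eqP -> /orP[] /eqP [] // <- <-; split.
Qed.

(** The parity of [size w] that selects the orientation in [perp] compensates the one in
    [snake_matchingP]. *)
Lemma perp_snake_matching w s : s \in fence w ->
  perp w (snake_matching (0, 0) w s) = head true s.
Proof.
move=> sw; have [/matchingP[mE _] sm] := snake_matchingP (0, 0) sw.
rewrite /perp; case: (odd _) sm => sm.
  have := sm false; rewrite addFb eqb_id => <-; apply/hasP/idP => [[e]|em].
    by rewrite mem_edges_at => /andP[em /(edge_at_origin (mE _ em)) []] ev _ /ev <-.
  by exists (side (0, 0) false); rewrite // mem_edges_at em.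
have := sm true; rewrite addTb eqb_id => <-; apply/hasP/idP => [[e]|em].
  by rewrite mem_edges_at => /andP[em /(edge_at_origin (mE _ em)) []] _ ev /ev <-.
by exists (side (0, 0) true); rewrite // mem_edges_at em.
Qed.

(** The other three sides of the square start at [p] or [step p (~~ c)], which the remaining snake
    avoids. *)
Lemma square_edge_next p c w e : e \in edges_of (step p c) w ->
  (e \in square_edges p) = (e == (step p c, step (step p c) (~~ c))).
Proof.
case/edge_ends/andP => e1 _; rewrite (in_square_edges p c).
have ne v v' : v \notin vertices_of (step p c) w -> (e == (v, v')) = false.
  by move=> vV; apply: contraNF vV => /eqP ee; move: e1; rewrite ee.
by rewrite !(ne p) ?origin_notin // (ne (step p (~~ c))) ?turn_notin // !orbF.
Qed.

Lemma count_squares_zero p w e : e \notin edges_of p w ->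
  count (fun s => e \in square_edges s) (corners p w) = 0.
Proof.
move=> eN; apply/eqP; rewrite -leqn0 leqNgt -has_count; apply: contra eN.
by case/hasP => s ss es; apply/edges_ofP; exists s.
Qed.

(** An old edge lying also on the new square is the shared one. With all bits false, that edge is
    either absent from the smaller matching or removed by the gluing. *)
Lemma basic_count p w e : e \in snake_matching p w (zeros w) ->
  count (fun s => e \in square_edges s) (corners p w) = 1.
Proof.
elim: w p => [|c w IH] p.
  rewrite /= => em; rewrite (_ : e \in _) //; move: em.
  rewrite /glue_square /= !inE (in_square_edges p true) => /or3P[/eqP ->|/eqP ->|/andP[/negbTE n1 n2]].
  - by rewrite eqxx !orbT.
  - by rewrite eqxx !orbT.
  - by rewrite (eqP n2) eqxx in n1.
have [/matchingP[mE _] sm] := snake_matchingP (step p c) (fence_nseq w).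
have pN v : (p, v) \notin edges_of (step p c) w.
  by apply/negP => /edge_ends/andP[]; rewrite (negbTE (origin_notin _ _ _)).
have bN v : (step p (~~ c), v) \notin edges_of (step p c) w.
  by apply/negP => /edge_ends/andP[]; rewrite (negbTE (turn_notin _ _ _)).
move: (sm c); rewrite /side => {}sm.
rewrite /= /glue_square /glue; case: eqP => cw; rewrite !inE.
  case/orP => [/eqP ->|em].
    by rewrite count_squares_zero // (in_square_edges p c) eqxx.
  rewrite IH // (square_edge_next (mE _ em)); case: eqP => // ee.
  by move: em; rewrite ee sm; case: (c) (odd _) cw => [] [].
case/or3P => [/eqP ->|/eqP ->|/andP[/negbTE en em]].
- by rewrite count_squares_zero // (in_square_edges p c) eqxx !orbT.
- by rewrite count_squares_zero // (in_square_edges p c) eqxx !orbT.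
- by rewrite IH // (square_edge_next (mE _ em)) en.
Qed.

Lemma basic_boundary w : snake_matching (0, 0) w (zeros w) `<=` boundary_edges w.
Proof.
apply/fsubsetP => e em; rewrite mem_boundary_edges snake_edgesE.
have [/matchingP[mE _] _] := snake_matchingP (0, 0) (fence_nseq w).
by rewrite mE // cardset_count -[1](basic_count em) corners_enum count_map eqxx.
Qed.

Lemma last_corners p w x y : last x (corners p w) = last y (corners p w).
Proof. by case: w. Qed.

Lemma mem_last_corners p w x : last x (corners p w) \in corners p w.
Proof. by case: w => [|c w] /=; rewrite ?mem_last ?inE. Qed.

(** The edge is the right side of the last square. For a single square, the bit false selects the
    two vertical sides, and no gluing of an earlier square touches this edge. *)
Lemma last_square_edge p w s : s \in fence w ->
  let v := last (0, 0) (corners p w) in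
  ((step v false, step (step v false) true) \in snake_matching p w s) = ~~ last false s.
Proof.
elim: w p s => [|c w IH] p s.
  case: p => i j; rewrite !inE; case/orP => /eqP ->; rewrite /= /glue_square /glue !inE /=.
    by rewrite !xpair_eqE !(eqn_leq i.+1) !ltnn.
  by rewrite eqxx orbT.
case/mem_fence_cons => x [s'] [-> s'w xs'] /=.
rewrite (last_corners _ _ _ (0, 0)); move: (mem_last_corners (step p c) w (0, 0)).
have -> : last x s' = last false s' by move: (fence_size s'w); case: (s').
rewrite -(IH (step p c)) //; set v := last _ _ => vw.
have [/matchingP[mE _] sm] := snake_matchingP (step p c) s'w.
have eE : (step v false, step (step v false) true) \in edges_of (step p c) w.
  by apply/edges_ofP; exists v => //; rewrite (in_square_edges _ true) stepC eqxx !orbT.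
rewrite mem_glue; last first.
- by move: (sm c); rewrite /side => ->; case: (x) (c) (odd _) (head _ _) xs' => [] [] [] [].
- by move=> ?; exact: sub_edges_start mE.
rewrite (square_edge_next eE) [X in _ (+) X (+) _](_ : _ = false); last first.
  apply: contraTF (edge_ends eE) => /eqP ->.
  by rewrite negb_and /= origin_notin.
(* The shared edge starts at [step p c], whose abscissa is at most that of [v]; the right side of
   square [v] starts one unit further. *)
rewrite [X in _ && X](_ : _ = false) ?andbF ?addbF //.
apply/eqP => /(congr1 fst) /= e1; have [] := corners_ge vw.
by rewrite -e1 ltnn.
Qed.

Lemma corners_step p w k : k < size w ->
  nth (0, 0) (corners p w) k.+1 = step (nth (0, 0) (corners p w) k) (nth false w k).
Proof.
elim: w p k => [|c w IH] p [|k] //= kw; last exact: IH.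
by case: (w).
Qed.

(* The edge shared by two consecutive squares lies neither in the matching nor
   in the basic one, so both squares are on the same side of the difference. *)
Lemma boundary_matching_constant w s k : s \in fence w ->
  snake_matching (0, 0) w s `<=` boundary_edges w -> k < size w ->
  nth false s k = nth false s k.+1.
Proof.
move=> sw /fsubsetP sb kw.
have k1 : k < (size w).+1 by exact: ltnW.
have k2 : k.+1 < (size w).+1 by [].
set i := Ordinal k1; set j := Ordinal k2.
have ij : i != j by rewrite -val_eqE /= neq_ltn ltnSn.
have cj : corner j = step (corner i) (nth false w k).
  by rewrite -!nth_corner /= corners_step.
pose e := (corner j, step (corner j) (~~ nth false w k)).
have ei : e \in square_edges (corner i).
  by rewrite (in_square_edges _ (nth false w k)) /e cj eqxx orbT.
have ej : e \in square_edges (corner j).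
  by rewrite (in_square_edges _ (nth false w k)) eqxx.
have eb : e \notin boundary_edges w.
  rewrite mem_boundary_edges; apply/negP => /andP[_ /cards1P[u uE]].
  have inu v : e \in square_edges (corner v) -> v = u.
    by move=> ev; apply/set1P; rewrite -uE in_set.
  by move: ij; rewrite (inu i) // (inu j) // eqxx.
apply/eqP; rewrite -negb_add -(mem_inner_edge (fun e => symdiff_zeros e sw) ij ei ej).
rewrite mem_symdiff negb_add.
by rewrite (contraNF (sb e) eb) (contraNF (fsubsetP (basic_boundary w) e) eb).
Qed.

(** This is the uniqueness of the basic matching: bits are constant along the snake, and the
    verticality of the last edge fixes the last one. *)
Lemma boundary_matching_zeros w s : s \in fence w ->
  snake_matching (0, 0) w s `<=` boundary_edges w -> ~~ last false s -> s = zeros w.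
Proof.
move=> sw sb; rewrite -nth_last (fence_size sw) /= => sl.
apply: (@eq_from_nth _ false) => [|k]; rewrite (fence_size sw) ?size_nseq // => kw.
rewrite nth_nseq kw.
have cst n : n <= size w -> nth false s (size w - n) = false.
  elim: n => [|n IH] nw; first by rewrite subn0 (negbTE sl).
  rewrite (boundary_matching_constant sw sb); last by rewrite ltn_subrL (leq_trans _ nw).
  by rewrite -subSn // subSS IH // ltnW.
by rewrite -(@subKn k (size w)) ?cst ?leq_subr.
Qed.

Lemma word_point_last w : last (0, 0) (corners (0, 0) w) = word_point w.
Proof.
rewrite -nth_last corners_size (nth_corner (@Ordinal (size w).+1 _ (ltnSn _))).
by rewrite /corner take_size.
Qed.

(** Both coordinates of every corner are bounded by those of the last, so only the last square
    reaches this vertex. *)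
Lemma vertical_at_top_right w e : e \in edges_of (0, 0) w -> vertical e ->
  incident (top_right w) e ->
  e = (step (word_point w) false, step (step (word_point w) false) true).
Proof.
case/edges_ofP => s /cornersP [k sk]; rewrite (in_square_edges _ false).
have [s1 s2] : s.1 <= (word_point w).1 /\ s.2 <= (word_point w).2.
  have le x : count_mem x (take k w) <= count_mem x w.
    by rewrite -[X in _ <= count _ X](cat_take_drop k) count_cat leq_addr.
  by rewrite sk; split; exact: le.
rewrite /top_right; case: (word_point w) s1 s2 => X Y; case: s {sk} => i j /= iX jY.
rewrite /vertical /incident.
have ne m n : m <= n -> (n.+1 == m) = false.
  by move=> mn; rewrite eqn_leq ltnNge mn.
case/or4P => /eqP -> /=; rewrite !xpair_eqE ?eqSS ?(ne _ _ iX) ?(ne _ _ jY) ?andbF ?eqn_leq ?ltnn //=.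
all: by rewrite -?eqn_leq ?andbF => // _ /andP[/eqP -> /eqP ->].
Qed.

Lemma vertical_top_right w s : s \in fence w ->
  has vertical (edges_at (snake_matching (0, 0) w s) (top_right w)) = ~~ last false s.
Proof.
move=> sw; have [/matchingP[mE _] _] := snake_matchingP (0, 0) sw.
rewrite -(last_square_edge (0, 0) sw) word_point_last.
apply/hasP/idP => [[e]|em].
  rewrite mem_edges_at => /andP[em ei ev].
  by rewrite -(vertical_at_top_right (mE _ em) ev ei).
exists (step (word_point w) false, step (step (word_point w) false) true).
  by rewrite mem_edges_at em /incident /top_right; case: (word_point w) => i j; rewrite eqxx orbT.
by rewrite /vertical.
Qed.

Lemma perfect_matching_fence w m : m \in perfect_matchings w ->
  exists2 s, s \in fence w & m = snake_matching (0, 0) w s.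
Proof. rewrite perfect_matchingsE; exact: snake_matching_onto. Qed.

Lemma fence_perfect_matching w s : s \in fence w ->
  snake_matching (0, 0) w s \in perfect_matchings w.
Proof. by case/(snake_matchingP (0, 0)); rewrite perfect_matchingsE. Qed.

Lemma basic_matching_zeros w :
  unique (basic_matching w) (snake_matching (0, 0) w (zeros w)).
Proof.
split=> [|m [/perfect_matching_fence[s sw ->] sb]].
  split; [exact/fence_perfect_matching/fence_nseq|exact: basic_boundary|].
  rewrite vertical_top_right ?fence_nseq //.
  by rewrite /zeros /=; elim: (size w).
by rewrite vertical_top_right // => /(boundary_matching_zeros sw sb) ->.
Qed.

(** The bit [d] lets one statement serve for perp- and parallel-matchings. *)
Lemma perm_matchings w d (A : {fset {fset edge}}) :
  (forall m, (m \in A) = (m \in perfect_matchings w) && (perp w m == d)) ->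
  perm_eq A [seq snake_matching (0, 0) w s | s <- fence w & head true s == d].
Proof.
move=> AE; apply: uniq_perm; first exact: fset_uniq.
  rewrite map_inj_in_uniq ?filter_uniq ?fence_uniq // => s t.
  by rewrite !mem_filter => /andP[_ sw] /andP[_ tw]; exact: snake_matching_inj.
move=> m; rewrite AE; apply/andP/mapP => [[/perfect_matching_fence[s sw ->]]|[s]].
  by rewrite perp_snake_matching // => sd; exists s; rewrite // mem_filter sd.
rewrite mem_filter => /andP[sd sw] ->; split; first exact: fence_perfect_matching.
by rewrite perp_snake_matching.
Qed.

Local Open Scope ring_scope.

(** * Generating functions *)

Definition fence_sum (d : bool) (w : word) : Kq :=
  \sum_(s <- fence w | head true s == d) q ^+ count id s.

Lemma sum_matchings w d (A : {fset {fset edge}}) :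
  (forall m, (m \in A) = (m \in perfect_matchings w) && (perp w m == d)) ->
  \sum_(m <- A) q ^+ area w (symdiff m (snake_matching (0, 0) w (zeros w))) =
  fence_sum d w.
Proof.
move=> /perm_matchings AE; rewrite (perm_big _ AE) big_map big_filter.
rewrite /fence_sum big_seq_cond [RHS]big_seq_cond.
by apply: eq_bigr => s /andP[sw _]; rewrite area_snake_matching.
Qed.

(** After the bit [t] both bits may follow, after [~~ t] only [~~ t] again; the new bit contributes
    a factor [q] when it is true. *)
Lemma fence_sum_cons d c w :
  let t := c == odd (size w) in
  fence_sum d (c :: w) =
  if d == t then q ^+ t * (fence_sum t w + fence_sum (~~ t) w)
  else q ^+ (~~ t) * fence_sum (~~ t) w.
Proof.
rewrite /fence_sum /=; set t := c == _.
rewrite big_cat !big_map big_filter_cond /=; have [->|dt] := eqVneq d t.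
  rewrite [X in _ + X = _]big1 ?addr0; last by move=> s; case: (t); rewrite /= ?andbF.
  rewrite mulrDr !mulr_sumr (bigID (fun s => head true s == t)) /=.
  congr (_ + _); apply: eq_big => s.
  - by case: (head _ _ == t).
  - by rewrite exprD.
  - by case: (t) (head _ _) => [] [].
  - by rewrite exprD.
rewrite big_pred0_eq add0r mulr_sumr; apply: eq_big => s; last by rewrite exprD.
by case: (d) (t) dt (head _ _) => [] [] // _ [].
Qed.

Lemma mulmx2 (a b c d x y : Kq) :
  mx2 a b c d *m col2 x y = col2 (a * x + b * y) (c * x + d * y).
Proof.
apply/matrixP => i j; rewrite !mxE !big_ord_recl big_ord0 addr0 !mxE.
by case: i => [[|[|i]] //].
Qed.

Definition letter_mx (t : bool) : 'M[Kq]_2 := if t then Rq else Lq.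

(** Scaling the second entry by [q] turns the recursion of [fence_sum_cons] into multiplication by
    [Rq] or [Lq]. The vector [col2 q q] is that of a single square, whose sums are [q] and 1. *)
Lemma fence_sum_theta u :
  (\prod_(t <- u) letter_mx t) *m col2 q q =
  col2 (fence_sum true (theta u)) (q * fence_sum false (theta u)).
Proof.
elim: u => [|t u IH].
  rewrite big_nil mul1mx /fence_sum /= !big_cons !big_nil /= expr1 expr0.
  by rewrite !addr0 mulr1.
have sz : size (theta u) = size u by elim: (u) => //= ? ? ->.
rewrite big_cons -mulmxA IH /letter_mx /= !fence_sum_cons sz.
(* The complementation in [theta] undoes the parity in [fence], so the matrix depends on the letter
   [t] alone. *)
have -> : ((if odd (size u) then t else ~~ t) == odd (size u)) = t.
  by case: (t) (odd _) => [] [].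
case: t => /=; rewrite mulmx2 ?expr1 ?expr0 ?mul1r ?mul0r ?add0r ?mulrDr //.
by rewrite addr0 [X in col2 _ X]addrC.
Qed.

Lemma prod_nseq (n : nat) (t : bool) :
  \prod_(x <- nseq n t) letter_mx x = letter_mx t ^+ n.
Proof. by elim: n => [|n IH]; rewrite ?big_nil // big_cons IH exprS. Qed.

(** The additional [Lq] makes up for the last exponent, which [cf_word] lowers by 1; positivity
    makes the truncated subtraction exact. *)
Lemma prod_cf_word l a : (0 < nth 0 a (2 * l + 1))%N ->
  (\prod_(t <- cf_word l.+1 a) letter_mx t) * Lq =
  \prod_(i < l.+1) (Rq ^+ nth 0%N a (2 * i) * Lq ^+ nth 0%N a (2 * i + 1)).
Proof.
move=> al; rewrite /cf_word big_flatten big_map -[iota _ _]/(index_iota 0 l.+1).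
rewrite big_nat_recr //= big_ord_recr /= -mulrA; congr (_ * _).
  rewrite -(big_mkord xpredT (fun i => Rq ^+ nth 0%N a (2 * i) * Lq ^+ nth 0%N a (2 * i + 1))).
  apply: eq_big_nat => i /andP[_ il].
  by rewrite big_cat !prod_nseq /= eqSS ltn_eqF // subn0.
by rewrite big_cat !prod_nseq /= eqxx -mulrA -exprSr subn1 prednK.
Qed.

Lemma q_neq0 : q != 0.
Proof. by rewrite /q tofrac_eq0 polyX_eq0. Qed.

Lemma mx2_diag_unit : mx2 1 0 0 q \in unitmx.
Proof.
rewrite unitmxE det_trig; last first.
  by apply/is_trig_mxP => -[[|[|i]] // i2] [[|[|j]] // j2] //; rewrite mxE.
by rewrite !big_ord_recl big_ord0 !mxE /= mulr1 mul1r unitfE q_neq0.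
Qed.

Theorem theoremD (x : rat) (l : nat) (a : seq nat)
    (x_gt0 : 0 < x) (l_gt0 : (0 < l)%N) (size_a : size a = (2 * l)%N)
    (cf_a : cf_expansion x a) :
  let w := theta (cf_word l a) in
  exists b : {fset edge},
    unique (basic_matching w) b /\
    col2 (\sum_(m <- perp_matchings w) q ^+ area w (symdiff m b))
         (\sum_(m <- par_matchings w) q ^+ area w (symdiff m b))
    = invmx (mx2 1 0 0 q)
      *m (\prod_(i < l) (Rq ^+ nth 0%N a (2 * i) * Lq ^+ nth 0%N a (2 * i + 1)))
      *m col2 1 0.
Proof.
move=> w; exists (snake_matching (0%N, 0%N) w (zeros w)); split.
  exact: basic_matching_zeros.
rewrite (sum_matchings (d := true)); last by move=> m; rewrite in_fset eqb_id.
rewrite (sum_matchings (d := false)); last by move=> m; rewrite in_fset eqbF_neg.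
case: l => [//|l] in size_a w l_gt0 *.
(* The index is at least 1, so this entry lies in [behead a], whose entries are positive. *)
have al : (0 < nth 0%N a (2 * l + 1))%N.
  case: a size_a cf_a {w} => [|a0 a] //= sa /andP[/allP pa _].
  by rewrite addn1 /=; apply: pa; rewrite mem_nth // -ltnS sa mulnS.
rewrite -prod_cf_word // -!mulmxA.
(* The last factor [Lq] produces the vector of the single square that starts the recursion. *)
have -> : Lq *m col2 1 0 = col2 q q by rewrite mulmx2 !mulr0 !addr0 mulr1.
rewrite fence_sum_theta.
apply: (canRL (mulKmx mx2_diag_unit)); rewrite mulmx2.
by rewrite !mul0r mul1r addr0 add0r.
Qed.
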